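(* Let $\mathbb{F}$ be an algebraically closed field of characteristic zero and let $(\mathcal{P},\circ,\{\cdot,\cdot\})$ be a finite-dimensional transposed Poisson algebra over $\mathbb{F}$. Denote by $\mathcal{R}$ the (solvable) radical of the Lie algebra $(\mathcal{P},\{\cdot,\cdot\})$. Then for every $i\geq 0$, $\mathcal{R}^{(i)}$ is a (not necessarily proper) ideal of the transposed Poisson algebra $\mathcal{P}$, i.e. $\mathcal{R}^{(i)}\circ\mathcal{P}\subset\mathcal{R}^{(i)}$ and $\{\mathcal{R}^{(i)},\mathcal{P}\}\subset\mathcal{R}^{(i)}$.
   Context: A transposed Poisson algebra is a vector space $\mathcal{P}$ with an associative commutative multiplication $\circ$ (not necessarily unital) and a Lie bracket $\{\cdot,\cdot\}$ such that $2x\circ\{y,z\}=\{x\circ y,z\}+\{y,x\circ z\}$ for all $x,y,z\in\mathcal{P}$. The derived series is $\mathcal{R}^{(0)}=\mathcal{R}$ and $\mathcal{R}^{(k)}=\{\mathcal{R}^{(k-1)},\mathcal{R}^{(k-1)}\}$ for $k\geq1$. *)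

(* Defs.v *)
From Stdlib Require Classical_Prop.
From mathcomp Require Import all_boot all_order all_algebra.

Set Implicit Arguments.
Unset Strict Implicit.
Unset Printing Implicit Defensive.

Import GRing.Theory.
Local Open Scope ring_scope.

Section TransposedPoisson.
Variables (F : fieldType) (P : vectType F).
Implicit Types (b mul br : {bilinear P -> P -> P}) (U V W I J R : {vspace P}).

Definition is_lie_bracket br : Prop :=
  (forall x, br x x = 0) /\
  (forall x y z, br x (br y z) + br y (br z x) + br z (br x y) = 0).

Definition is_transposed_poisson mul br : Prop :=
  [/\ associative mul, commutative mul, is_lie_bracket br &
      forall x y z, mul x (br y z) *+ 2 = br (mul x y) z + br y (mul x z)].

(* Span of all b u v with u \in U, v \in V; see [bprod_subP]. *)
Definition bprod b U V : {vspace P} :=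
  <<[seq b u v | u <- vbasis U, v <- vbasis V]>>%VS.

Definition derived br U (k : nat) : {vspace P} :=
  iter k (fun V => bprod br V V) U.

(* One-sided; two-sided for the (anti)commutative products considered here. *)
Definition is_ideal b I : Prop := (bprod b I fullv <= I)%VS.

Definition is_solvable br U : Prop := exists k, derived br U k = 0%VS.

(* The greatest solvable ideal; see [radical_exists] and [radical_unique]. *)
Definition is_radical br R : Prop :=
  [/\ is_ideal br R, is_solvable br R &
      forall I, is_ideal br I -> is_solvable br I -> (I <= R)%VS].

Definition is_tp_ideal mul br I : Prop := is_ideal mul I /\ is_ideal br I.

Lemma memv_bprod b U V u v : u \in U -> v \in V -> b u v \in bprod b U V.
Proof.
move=> /coord_vbasis-> /coord_vbasis->.
rewrite linear_sumlz; apply: memv_suml => i _.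
rewrite linear_sumr; apply: memv_suml => j _.
rewrite linearZl_LR linearZr_LR; apply/memvZ/memvZ/memv_span/allpairs_f;
  by rewrite mem_nth ?size_tuple.
Qed.

Lemma bprod_subP b U V W :
  reflect (forall u v, u \in U -> v \in V -> b u v \in W) (bprod b U V <= W)%VS.
Proof.
apply: (iffP idP) => [/subvP sW u v uU vV | sW]; first exact/sW/memv_bprod.
by apply/span_subvP => _ /allpairsP[[u v] [/vbasis_mem uU /vbasis_mem vV ->]];
  apply: sW.
Qed.

Lemma is_idealP b I : is_ideal b I <-> forall x y, x \in I -> b x y \in I.
Proof.
split=> [/bprod_subP sI x y xI | sI]; first by apply: sI; rewrite ?memvf.
by apply/bprod_subP => x y xI _; apply: sI.
Qed.

Lemma lie_anti br : is_lie_bracket br -> forall x y, br x y = - br y x.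
Proof.
case=> br0 _ x y; apply/eqP; rewrite -addr_eq0; apply/eqP.
by have := br0 (x + y); rewrite linearDl /= !linearDr /= !br0 add0r addr0.
Qed.

Lemma bprodS b U U' V V' :
  (U <= U')%VS -> (V <= V')%VS -> (bprod b U V <= bprod b U' V')%VS.
Proof.
move=> /subvP sU /subvP sV; apply/bprod_subP => u v uU vV.
by apply: memv_bprod; [apply: sU | apply: sV].
Qed.

Lemma derivedS br U V k : (U <= V)%VS -> (derived br U k <= derived br V k)%VS.
Proof. by move=> sUV; elim: k => //= k IHk; apply: bprodS. Qed.

Lemma ideal_add b I J : is_ideal b I -> is_ideal b J -> is_ideal b (I + J)%VS.
Proof.
move=> /is_idealP iI /is_idealP iJ; apply/is_idealP => x y.
case/memv_addP=> u uI [v vJ ->]; rewrite linearDl.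
by apply: memv_add; [apply: iI | apply: iJ].
Qed.

Lemma derived_add br U J k : is_lie_bracket br -> is_ideal br J ->
  (derived br (U + J) k <= derived br U k + J)%VS.
Proof.
move=> brL /is_idealP iJ; elim: k => //= k /subvP IHk.
apply/bprod_subP => x y /IHk/memv_addP[u uU [v vJ ->]].
case/IHk/memv_addP=> u' uU' [v' vJ' ->].
rewrite linearDl /= linearDr /= -addrA; apply: memv_add.
  exact: memv_bprod.
apply: memvD; last exact: iJ.
by rewrite (lie_anti brL) memvN; apply: iJ.
Qed.

Lemma solvable_add br I J : is_lie_bracket br -> is_ideal br J ->
  is_solvable br I -> is_solvable br J -> is_solvable br (I + J)%VS.
Proof.
move=> brL iJ [m I0] [n J0]; exists (n + m)%N; apply/eqP.
rewrite -subv0 -J0 /derived iterD; apply: derivedS.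
by have := derived_add I m brL iJ; rewrite I0 add0v.
Qed.

Lemma radical_exists br : is_lie_bracket br -> exists R, is_radical br R.
Proof.
move=> brL.
suff step n I : is_ideal br I -> is_solvable br I ->
    (\dim (fullv : {vspace P}) - \dim I < n)%N -> exists R, is_radical br R.
  apply: (step _ 0%VS) (ltnSn _); last by exists 0%N.
  by apply/is_idealP => x y /[!memv0] /eqP->; rewrite linear0l.
elim: n I => // n IHn I iI sI ltIn.
have [[J [iJ sJ nJI]] | noJ] := Classical_Prop.classic
    (exists J, [/\ is_ideal br J, is_solvable br J & ~~ (J <= I)%VS]).
  apply: (IHn (I + J)%VS); [exact: ideal_add | exact: solvable_add |].
  have ltI : (\dim I < \dim (I + J))%N.
    rewrite ltnNge; apply: contra nJI => leIJ.
    by rewrite (eqP (_ : I == I + J)%VS) ?addvSr // eqEdim addvSl.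
  apply: leq_trans (ltn_sub2l _ ltI) ltIn.
  exact: leq_trans ltI (dimvS (subvf _)).
exists I; split=> // J iJ sJ; apply/negPn/negP => nJI.
by apply: noJ; exists J.
Qed.

Lemma radical_unique br R R' : is_radical br R -> is_radical br R' -> R = R'.
Proof.
move=> [iR sR maxR] [iR' sR' maxR']; apply/eqP.
by rewrite eqEsubv maxR' ?maxR.
Qed.

End TransposedPoisson.

(* Main.v *)
Require Import Defs.
From mathcomp Require Import all_boot all_order all_algebra.

(** In a transposed Poisson algebra every multiplication operator [f = mul h]
    satisfies [2 f [x, y] = [f x, y] + [x, f y]]: it is a half-derivation of the
    Lie algebra. It is therefore enough to show that half-derivations preserve
    the radical [R], and that subspaces preserved by a half-derivation have
    derived subspaces preserved by it; the latter is immediate from the identity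
    once 2 is invertible ([half_derivation_derived]).

    For the radical, the idea is that [R + f R] is a solvable ideal, so that
    maximality of [R] gives [f R <= R]. Take [r] in [R]. Since [[r, f y]] is in
    [R], the identity reads [[f r, y] = 2 f [r, y]] modulo [R]; in particular
    [R + f R] is an ideal. Thus [f], as a map from [R] to the quotient by [R],
    intertwines the two adjoint actions up to a factor 2. Such a factor is
    incompatible with commutators: evaluating [[f r, [y, z]]] directly gives
    [2 f [r, [y, z]]], while expanding it by the Jacobi identity and applying the
    intertwining rule twice gives [4 f [r, [y, z]]]. Hence [[f r, [y, z]]] is in
    [R] ([half_derivation_centralises]), so the second derived subspace of
    [R + f R] lies in the solvable ideal [R], and [R + f R] is solvable. *)

Set Implicit Arguments.
Unset Strict Implicit.
Unset Printing Implicit Defensive.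

Import GRing.Theory.
Local Open Scope ring_scope.

Section HalfDerivations.
Variables (F : fieldType) (P : vectType F) (br : {bilinear P -> P -> P}).
Hypothesis brL : is_lie_bracket br.
Implicit Types (f : 'End(P)) (U I R : {vspace P}).

Definition is_half_derivation f : Prop :=
  forall x y, f (br x y) *+ 2 = br (f x) y + br x (f y).

Lemma lie_jacobi x y z : br x (br y z) = br (br x y) z - br (br x z) y.
Proof.
case: (brL) => _ /(_ x y z) /eqP; rewrite -addrA addr_eq0 => /eqP->.
rewrite [br y _](lie_anti brL) [br z (br _ _)](lie_anti brL).
by rewrite (lie_anti brL z x) linearNl /= opprD !opprK addrC.
Qed.

Lemma ideal_memr I x y : is_ideal br I -> y \in I -> br x y \in I.
Proof. by move=> /is_idealP iI yI; rewrite (lie_anti brL) memvN iI. Qed.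

Lemma ideal_derived I k : is_ideal br I -> is_ideal br (derived br I k).
Proof.
move=> iI; elim: k => //= k iD; apply/is_idealP => w x wD.
rewrite (lie_anti brL) memvN -(lfunE (br x)) memv_preim.
apply: subvP w wD; apply/bprod_subP => u v uD vD.
rewrite -memv_preim lfunE /= lie_jacobi.
by apply: memvB; apply: memv_bprod => //; apply: ideal_memr.
Qed.

Lemma solvable_derived_sub U R n :
  is_solvable br R -> (derived br U n <= R)%VS -> is_solvable br U.
Proof.
move=> [m R0] sUR; exists (m + n)%N; apply/eqP.
by rewrite -subv0 -R0 /derived iterD; apply: derivedS.
Qed.

Lemma half_derivation_derived f U k : 2%:R != 0 :> F ->
    is_half_derivation f -> (f @: U <= U)%VS ->
  (f @: derived br U k <= derived br U k)%VS.
Proof.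
move=> nz2 hf sfU; elim: k => //= k; set D := derived br U k => sfD.
have memfD u : u \in D -> f u \in D by move=> uD; apply/(subvP sfD)/memv_img.
apply/subvP => _ /memv_imgP[w wD ->]; rewrite memv_preim.
apply: subvP w wD; apply/bprod_subP => u v uD vD; rewrite -memv_preim.
have -> : f (br u v) = 2%:R^-1 *: (br (f u) v + br u (f v)).
  by rewrite -hf -scaler_nat scalerA mulVf ?scale1r.
by apply/memvZ/memvD; apply: memv_bprod; rewrite ?memfD.
Qed.

(** The term [[r, f y]] of the defining identity lies in the ideal; what is left
    says that [f], from [I] to the quotient by [I], intertwines the adjoint
    actions up to a factor 2. *)
Lemma half_derivation_twist f I r y : is_half_derivation f -> is_ideal br I ->
  r \in I -> br (f r) y - f (br r y) *+ 2 \in I.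
Proof.
move=> hf /is_idealP iI rI.
by rewrite hf opprD addrA subrr add0r memvN iI.
Qed.

(** Modulo [I], the bracket [[f r, [y, z]]] is both [2 f [r, [y, z]]] and, by the
    Jacobi identity, [4 f [r, [y, z]]]; so it is twice the first value minus the
    second, that is 0. *)
Lemma half_derivation_centralises f I r y z :
    is_half_derivation f -> is_ideal br I -> r \in I ->
  br (f r) (br y z) \in I.
Proof.
move=> hf iI rI; have /is_idealP memI := iI.
have twist s t : s \in I -> br (f s) t - f (br s t) *+ 2 \in I.
  exact: half_derivation_twist.
have twist2 s t : br (br (f r) s) t - f (br (br r s) t) *+ 4 \in I.
  have := memvD (memI _ t (twist r s rI)) (rpredMn 2 (twist _ t (memI _ s rI))).
  rewrite linearBl /= linearMnl /= mulrnBl -mulrnA addrA subrK; exact.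
have once := twist r (br y z) rI.
have twice : br (f r) (br y z) - f (br r (br y z)) *+ 4 \in I.
  rewrite !lie_jacobi raddfB /= mulrnBl opprD addrACA -opprD.
  exact: memvB (twist2 y z) (twist2 z y).
have := memvB (rpredMn 2 once) twice.
by rewrite mulrnBl -mulrnA opprB addrA subrK mulr2n addrK.
Qed.

(** By the intertwining rule, [[f r, y]] is [f (2 [r, y])] up to an element of
    [I]. *)
Lemma half_derivation_ideal_add f I : is_half_derivation f -> is_ideal br I ->
  is_ideal br (I + f @: I)%VS.
Proof.
move=> hf iI; have /is_idealP memI := iI; apply/is_idealP => x y.
case/memv_addP=> u uI [_ /memv_imgP[r rI ->] ->].
rewrite linearDl /= -(subrK (f (br r y) *+ 2) (br (f r) y)) addrA.
apply: memv_add; last by rewrite rpredMn ?memv_img ?memI.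
by apply: memvD; [apply: memI | apply: half_derivation_twist].
Qed.

(** [R + f R] is a solvable ideal, hence contained in the greatest one. *)
Lemma half_derivation_radical f R : is_half_derivation f ->
  is_radical br R -> (f @: R <= R)%VS.
Proof.
move=> hf [iR sR maxR]; have /is_idealP memR := iR.
apply: subv_trans (addvSr R _) (maxR _ (half_derivation_ideal_add hf iR) _).
apply: (solvable_derived_sub (n := 2) sR) => /=.
set J := (R + f @: R)%VS.
(* The commutator of [J] lies in [J], as [J] is an ideal, and is annihilated by
   [J] modulo [R]. *)
have sJ : (bprod br J J <= J)%VS.
  exact: subv_trans (bprodS _ _ (subvf J)) (half_derivation_ideal_add hf iR).
apply/bprod_subP => x w /(subvP sJ) /memv_addP[u uR [_ /memv_imgP[r rR ->] ->]].
move=> wJ; rewrite linearDl; apply: memvD; first exact: memR.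
rewrite -(lfunE (br (f r))) memv_preim.
apply: subvP w wJ; apply/bprod_subP => y z _ _; rewrite -memv_preim lfunE.
exact: half_derivation_centralises.
Qed.

End HalfDerivations.

Theorem theorem11 (F : closedFieldType) (charF0 : [pchar F] =i pred0)
    (P : vectType F) (mul br : {bilinear P -> P -> P})
    (tpP : is_transposed_poisson mul br)
    (R : {vspace P}) (radR : is_radical br R) (i : nat) :
  is_tp_ideal mul br (derived br R i).
Proof.
case: tpP => _ mulC brL tp; have [iR _ _] := radR.
split; last exact: ideal_derived.
have nz2 : 2%:R != 0 :> F by rewrite (proj1 (pcharf0P F) charF0).
apply/is_idealP => x y xD; rewrite mulC.
have hf : is_half_derivation br (linfun (mul y)).
  by move=> u v; rewrite !lfunE; apply: tp.
have /subvP := half_derivation_derived i nz2 hf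
  (half_derivation_radical brL hf radR).
by move=> /(_ _ (memv_img _ xD)); rewrite lfunE.
Qed.
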